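(* For every integer $n\ge 2$, $\chi_{la}(f_n\circ O_1)=2n+3$.
   Context: All graphs are finite, undirected, without loops or multiple edges. The friendship graph $f_n$ ($n\ge 2$) is the graph consisting of $n$ triangles sharing exactly one common vertex (so it has $2n+1$ vertices and $3n$ edges). $O_1$ is the null graph of order $1$ (a single vertex). The corona product $G\circ H$ is the graph obtained by taking one copy of $G$ and $|V(G)|$ disjoint copies of $H$, and joining the $i$-th vertex of $G$ to every vertex of the $i$-th copy of $H$, for $1\le i\le |V(G)|$; thus $G\circ O_1$ is $G$ with one pendant vertex attached to each vertex of $G$. For a connected graph $G=(V,E)$ with $q=|E|$ and a bijection $f:E\to\{1,2,\dots,q\}$, the weight of a vertex $u$ is $w(u)=\sum_{e\in E(u)} f(e)$, where $E(u)$ is the set of edges incident to $u$. The bijection $f$ is a local antimagic labeling of $G$ if $w(u)\ne w(v)$ for every two adjacent vertices $u,v$. Assigning the color $w(u)$ to each vertex $u$ then gives a proper vertex coloring of $G$, whose number of colors is the number of distinct values of $w$. The local antimagic chromatic number $\chi_{la}(G)$ is the minimum number of distinct colors $|\{w(u): u\in V\}|$ over all local antimagic labelings $f$ of $G$. *)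

(* Defs.v *)
From mathcomp Require Import all_boot.

Set Implicit Arguments.
Unset Strict Implicit.
Unset Printing Implicit Defensive.

Record sgraph := SGraph {
  vertex :> finType;
  adj : rel vertex;
  adj_sym : symmetric adj;
  adj_irrefl : irreflexive adj }.

Definition edges (G : sgraph) : {set {set G}} :=
  [set A : {set G} | [exists x, exists y, adj x y && (A == [set x; y])]].

(* Labelings are functions on all vertex sets; only their values on [edges G]
   are ever constrained or used. *)
Definition edge_bijection (G : sgraph) (f : {set G} -> nat) : Prop :=
  [/\ {in edges G, forall e, 1 <= f e <= #|edges G|},
      {in edges G &, injective f} &
      forall k, 1 <= k <= #|edges G| -> exists2 e, e \in edges G & f e = k].

Definition weight (G : sgraph) (f : {set G} -> nat) (u : G) : nat :=
  \sum_(e in edges G | u \in e) f e.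

Definition local_antimagic (G : sgraph) (f : {set G} -> nat) : Prop :=
  edge_bijection f /\ forall u v : G, adj u v -> weight f u <> weight f v.

Definition num_colors (G : sgraph) (f : {set G} -> nat) : nat :=
  size (undup [seq weight f u | u : G]).

(* A relation rather than a function: a graph such as K_2 has no local
   antimagic labeling, and then no [k] is its chromatic number. *)
Definition is_chi_la (G : sgraph) (k : nat) : Prop :=
  (exists2 f : {set G} -> nat, local_antimagic f & num_colors f = k) /\
  (forall f : {set G} -> nat, local_antimagic f -> k <= num_colors f).

(* [None] is the common vertex; the i-th triangle is
   [None], [Some (i, false)], [Some (i, true)]. *)
Definition friendship_adj n : rel (option ('I_n * bool)) := fun x y =>
  match x, y with
  | None, None => false
  | None, Some _ | Some _, None => true
  | Some (i, a), Some (j, b) => (i == j) && (a != b)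
  end.

Fact friendship_adj_sym n : symmetric (@friendship_adj n).
Proof.
by move=> [[i a]|] [[j b]|] //=; rewrite eq_sym [a == b]eq_sym.
Qed.

Fact friendship_adj_irrefl n : irreflexive (@friendship_adj n).
Proof. by move=> [[i a]|] //=; rewrite !eqxx. Qed.

Definition friendship (n : nat) : sgraph :=
  SGraph (@friendship_adj_sym n) (@friendship_adj_irrefl n).

Definition null_adj m : rel 'I_m := fun _ _ => false.

Fact null_adj_sym m : symmetric (@null_adj m).
Proof. by []. Qed.

Fact null_adj_irrefl m : irreflexive (@null_adj m).
Proof. by []. Qed.

Definition null_graph (m : nat) : sgraph :=
  SGraph (@null_adj_sym m) (@null_adj_irrefl m).

(* [inr (x, h)] is the vertex [h] in the copy of [H] attached to [x]. *)
Definition corona_adj (G H : sgraph) : rel (G + G * H)%type := fun u v =>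
  match u, v with
  | inl x, inl y => adj x y
  | inl x, inr (y, _) => x == y
  | inr (x, _), inl y => x == y
  | inr (x, h), inr (y, k) => (x == y) && adj h k
  end.

Fact corona_adj_sym G H : symmetric (@corona_adj G H).
Proof.
by move=> [x|[x h]] [y|[y k]] /=; rewrite 1?eq_sym // adj_sym.
Qed.

Fact corona_adj_irrefl G H : irreflexive (@corona_adj G H).
Proof. by move=> [x|[x h]] /=; rewrite adj_irrefl ?andbF. Qed.

Definition corona (G H : sgraph) : sgraph :=
  SGraph (@corona_adj_sym G H) (@corona_adj_irrefl G H).

(* Main.v *)
(** Lower bound: the 2n+1 pendant vertices have distinct colors, all at most
    the number 5n+1 of edges.  The hub has weight at least (2n+1)(n+1) > 5n+1,
    and averaging shows that some rim vertex also has weight above 5n+1; the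
    two are adjacent, which gives two further colors.

    Upper bound: in every triangle one rim vertex gets weight 8n+2 and the other
    one 5n+1, which is also the label of the pendant edge at the hub, so only
    the hub and the weight 8n+2 add to the pendant colors. *)

Require Import Defs.
From mathcomp Require Import all_boot zify.

Set Implicit Arguments.
Unset Strict Implicit.
Unset Printing Implicit Defensive.

(** Induction removing an element of largest value: the values on [A] are distinct and lie in
    [1..g x], so that largest value [g x] is at least [#|A|]. *)
Lemma inj_pos_sum_ge (T : finType) (g : T -> nat) (A : {set T}) :
  injective g -> (forall x, 0 < g x) ->
  #|A| * #|A|.+1 <= 2 * \sum_(x in A) g x.
Proof.
move=> g_inj g_gt0; have [m] := ubnP #|A|.
elim: m A => // m IHm A leAm.
have [->|[x0 Ax0]] := set_0Vmem A; first by rewrite cards0.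
case: (@arg_maxnP _ x0 (mem A) g Ax0) => x Ax xmax.
have gx_ge : #|A| <= g x.
  have /(uniq_leq_size (s2 := iota 1 (g x))) : uniq [seq g y | y in A].
    by rewrite map_inj_uniq ?enum_uniq.
  rewrite size_map -cardE size_iota; apply=> _ /mapP[y Ay ->].
  rewrite mem_iota g_gt0 add1n ltnS.
  by apply: xmax; rewrite mem_enum in Ay.
rewrite (big_setD1 x Ax) /=.
have cardA : #|A| = #|A :\ x|.+1 by rewrite (cardsD1 x A) [x \in A]Ax.
have := IHm (A :\ x); nia.
Qed.

(** * Edges of the corona and vertex weights *)

Section FriendshipCorona.

Variable n : nat.

Let G := corona (friendship n) (null_graph 1).
Let rim := ('I_n * bool)%type.

Let hub : G := inl None.
Let rimv (p : rim) : G := inl (Some p).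
Let leaf (x : option rim) : G := inr (x, ord0).

(** Sums over this type split by kind of edge through [big_sumType], which sums over the set of sets
    [edges G] do not. *)
Definition edge_index := (option ('I_n * bool) + ('I_n * bool) + 'I_n)%type.

Let pend (x : option rim) : edge_index := inl (inl x).
Let spoke (p : rim) : edge_index := inl (inr p).
Let base (i : 'I_n) : edge_index := inr i.

Definition indexed_edge (k : edge_index) : {set G} :=
  match k with
  | inl (inl x) => [set inl x; leaf x]
  | inl (inr p) => [set hub; rimv p]
  | inr i => [set rimv (i, false); rimv (i, true)]
  end.

Lemma vertexP (u : G) : (exists x, u = leaf x) \/ u = hub \/ exists p, u = rimv p.
Proof.
case: u => [[p|]|[x h]]; [right; right; by exists p | by right; left | left].
by exists x; rewrite /leaf [h]ord1.
Qed.

Lemma leaf_indexed_edge x k : (leaf x \in indexed_edge k) = (k == pend x).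
Proof.
case: k => [[y|p]|i]; rewrite !inE // [RHS]eq_sym /eq_op /=.
by rewrite xpair_eqE eqxx andbT.
Qed.

Lemma hub_indexed_edge k :
  (hub \in indexed_edge k) =
  match k with inl (inl None) | inl (inr _) => true | _ => false end.
Proof. by case: k => [[[q|]|q]|i]; rewrite !inE. Qed.

Lemma rim_indexed_edge p k :
  (rimv p \in indexed_edge k) =
  match k with
  | inl (inl None) => false
  | inl (inl (Some q)) | inl (inr q) => p == q
  | inr i => p.1 == i
  end.
Proof.
case: k => [[[q|]|q]|i]; rewrite !inE ?orbF //.
case: p => j b; rewrite /rimv ![inl _ == _]/eq_op /= ![Some _ == _]/eq_op /=.
by rewrite !xpair_eqE -andb_orr; case: b; rewrite andbT.
Qed.

(** Single vertices separate the edges: a leaf lies on one edge only, the hub lies on every spoke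
    and on no base edge, and a rim vertex lies on one spoke and one base edge. *)
Lemma indexed_edge_inj : injective indexed_edge.
Proof.
move=> k l /setP eq_kl.
case: k l eq_kl => [[x|p]|i] [[y|q]|j] eq_kl; try by
  [ have := eq_kl (leaf x); rewrite !leaf_indexed_edge eqxx => /esym/eqP
  | have := eq_kl (leaf y); rewrite !leaf_indexed_edge eqxx => /eqP
  | have := eq_kl hub; rewrite !hub_indexed_edge ].
- by have := eq_kl (rimv p); rewrite !rim_indexed_edge eqxx => /esym/eqP ->.
- by have := eq_kl (rimv (i, false)); rewrite !rim_indexed_edge eqxx => /esym/eqP <-.
Qed.

Lemma indexed_edgeE : edges G = [set indexed_edge k | k : edge_index].
Proof.
apply/setP => A; apply/idP/imsetP => [|[k _ ->]].
- rewrite inE => /existsP[u /existsP[v /andP[uv /eqP->]]].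
  case: u v uv => [x|[x h]] [y|[y k]] //=; last by rewrite andbF.
  + case: x y => [[i a]|] [[j b]|] //=; first last.
    * by exists (spoke (j, b)).
    * by exists (spoke (i, a)); rewrite // setUC.
    case/andP => /eqP-> ab; exists (base j) => //=.
    by case: a b ab => [] [] //= _; rewrite setUC.
  + by move=> /eqP->; exists (pend y); rewrite // [k]ord1.
  + by move=> /eqP->; exists (pend y); rewrite // [h]ord1 setUC.
- rewrite inE; apply/existsP; case: k => [[x|p]|i].
  + by exists (inl x); apply/existsP; exists (leaf x); rewrite /= !eqxx.
  + by exists hub; apply/existsP; exists (rimv p); rewrite /= eqxx.
  + exists (rimv (i, false)); apply/existsP; exists (rimv (i, true)).
    by rewrite /= !eqxx.
Qed.

Lemma card_edge_index : #|{: edge_index}| = 5 * n + 1.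
Proof. by rewrite !(card_sum, card_option, card_prod) card_bool card_ord; lia. Qed.

Lemma card_edges : #|edges G| = 5 * n + 1.
Proof. by rewrite indexed_edgeE (card_imset _ indexed_edge_inj) card_edge_index. Qed.

(** The summand is arbitrary because labels give the hub weight and the constant 1 gives the hub
    degree. *)
Lemma sum_hub_edges (h : edge_index -> nat) :
  \sum_(k | hub \in indexed_edge k) h k = h (pend None) + \sum_p h (spoke p).
Proof.
rewrite (eq_bigl _ _ hub_indexed_edge) !big_sumType /=.
by rewrite (big_pred1 None) ?big_pred0_eq ?addn0 // => -[].
Qed.

Section Weights.

Variable f : {set G} -> nat.
Let g k := f (indexed_edge k).

Lemma weight_indexed u :
  weight f u = \sum_(k | u \in indexed_edge k) g k.
Proof.
rewrite /weight indexed_edgeE big_imset_cond => [|k l _ _]; last exact: indexed_edge_inj.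
by apply: eq_bigl => A.
Qed.

Lemma weight_leaf x : weight f (leaf x) = g (pend x).
Proof.
by rewrite weight_indexed (big_pred1 (pend x)) // => k; rewrite leaf_indexed_edge.
Qed.

Lemma weight_hub : weight f hub = g (pend None) + \sum_p g (spoke p).
Proof. by rewrite weight_indexed sum_hub_edges. Qed.

Lemma weight_rim p :
  weight f (rimv p) = g (pend (Some p)) + g (spoke p) + g (base p.1).
Proof.
rewrite weight_indexed (eq_bigl _ _ (rim_indexed_edge p)) !big_sumType /=.
rewrite (big_pred1 (Some p)) => [|[q|] //=]; last by rewrite eq_sym.
by rewrite (big_pred1 p) ?(big_pred1 p.1) // => q; rewrite eq_sym.
Qed.

End Weights.

(** * Lower bound on the number of colors *)

Section LowerBound.

Variable f : {set G} -> nat.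
Hypothesis f_bij : edge_bijection f.
Let g k := f (indexed_edge k).

Lemma edge_label_inj : injective g.
Proof.
have [_ f_inj _] := f_bij; move=> k l /f_inj eq_kl.
by apply: indexed_edge_inj; apply: eq_kl; rewrite indexed_edgeE imset_f.
Qed.

Lemma edge_label_range k : 1 <= g k <= 5 * n + 1.
Proof.
by have [+ _ _] := f_bij; rewrite card_edges; apply; rewrite indexed_edgeE imset_f.
Qed.

Lemma edge_label_gt0 k : 0 < g k.
Proof. by case/andP: (edge_label_range k). Qed.

(** The [2n+1] distinct labels at the hub sum to at least [(2n+1)(n+1) = 2n^2+3n+1]. *)
Lemma weight_hub_gt : 1 < n -> 5 * n + 1 < weight f hub.
Proof.
move=> n_gt1; pose A := [set k | hub \in indexed_edge k].
have cardA : #|A| = 2 * n + 1.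
  rewrite -sum1_card (eq_bigl (fun k => hub \in indexed_edge k)); last first.
    by move=> k; rewrite inE.
  by rewrite sum_hub_edges sum1_card card_prod card_bool card_ord; lia.
have := inj_pos_sum_ge A edge_label_inj edge_label_gt0.
rewrite cardA (eq_bigl (fun k => hub \in indexed_edge k)); last first.
  by move=> k; rewrite inE.
by rewrite -weight_indexed; nia.
Qed.

(* Every edge except the pendant one at the hub meets the rim, so the rim
   weights sum to at least 5n(5n+1)/2 > 2n(5n+1). *)
Lemma exists_weight_rim_gt : 0 < n -> exists p, 5 * n + 1 < weight f (rimv p).
Proof.
move=> n_gt0; apply/existsP; apply: contraT; rewrite negb_exists => /forallP small.
pose A := [set~ pend None].
have cardA : #|A| = 5 * n by rewrite cardsC1 card_edge_index addn1.
have := inj_pos_sum_ge A edge_label_inj edge_label_gt0; rewrite cardA.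
have: \sum_(k in A) g k <= \sum_p weight f (rimv p).
  rewrite (eq_bigr _ (fun p _ => weight_indexed f (rimv p))).
  (* After the exchange each label is counted once per rim vertex on its edge, hence at least once
     on [A]; the part outside [A] is dropped. *)
  rewrite (exchange_big_dep xpredT) //= [leqRHS](bigID (mem A)) /=.
  apply: leq_trans (leq_addr _ _); apply: leq_sum => k.
  rewrite !inE => k_neq.
  have [p kp] : exists p, rimv p \in indexed_edge k.
    case: k k_neq => [[[q|]|q]|i] // _; try by exists q; rewrite rim_indexed_edge.
    by exists (i, false); rewrite rim_indexed_edge /=.
  by rewrite (bigD1 p) //= leq_addr.
have: \sum_p weight f (rimv p) <= \sum_(p : rim) (5 * n + 1).
  by apply: leq_sum => p _; rewrite leqNgt small.
(* The bounds combine to [5n(5n+1) <= 4n(5n+1)], absurd for [n > 0]. *)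
rewrite sum_nat_const card_prod card_bool card_ord; nia.
Qed.

End LowerBound.

Lemma num_colors_ge f : 1 < n -> local_antimagic f -> 2 * n + 3 <= @num_colors G f.
Proof.
move=> n_gt1 [f_bij f_la].
have w_hub := weight_hub_gt f_bij n_gt1.
have [|p w_p] := exists_weight_rim_gt f_bij; first by lia.
have w_leaf x : weight f (leaf x) <= 5 * n + 1.
  by rewrite weight_leaf; case/andP: (edge_label_range f_bij (pend x)).
pose s := [seq weight f u | u <- hub :: rimv p :: [seq leaf x | x : option rim]].
have s_size : size s = 2 * n + 3.
  rewrite size_map /= size_map -cardE card_option card_prod card_bool card_ord.
  by lia.
rewrite -s_size; apply: uniq_leq_size; last first.
  by move=> _ /mapP[u _ ->]; rewrite mem_undup; apply/codomP; exists u.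
rewrite /s !map_cons !cons_uniq inE negb_or -map_comp -!andbA; apply/and4P; split.
(* Hub and rim vertex both exceed [5n+1], so only their adjacency separates them; size separates
   each of them from the leaves. *)
- by apply/eqP; apply: f_la.
- by apply/mapP => -[x _ /= eq_w]; have := w_leaf x; rewrite -eq_w; lia.
- by apply/mapP => -[x _ /= eq_w]; have := w_leaf x; rewrite -eq_w; lia.
- rewrite map_inj_uniq ?enum_uniq // => x y /=; rewrite !weight_leaf.
  by move/(edge_label_inj f_bij) => [].
Qed.

(** * An explicit labeling for the upper bound *)

(* On the i-th triangle the three edges at a rim vertex have labels growing by
   1, 1 and -2 with i, so that each rim weight is independent of i; the two
   progressions of step -2 interleave. *)
Definition label (k : edge_index) : nat :=
  match k with
  | inl (inl None) => 5 * n + 1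
  | inl (inl (Some (i, b))) => if b then 4 * n - 1 - 2 * i else 4 * n - 2 * i
  | inl (inr (i, b)) => if b then n + i + 1 else 4 * n + i + 1
  | inr i => i + 1
  end.

(** The sum transports [label] along [indexed_edge]: it has a single term on an edge and is 0 on any
    other set. *)
Definition labeling (A : {set G}) : nat := \sum_(k | indexed_edge k == A) label k.

Lemma labeling_indexed k : labeling (indexed_edge k) = label k.
Proof.
by rewrite /labeling (big_pred1 k) // => l; rewrite (inj_eq indexed_edge_inj).
Qed.

Lemma label_range k : 1 <= label k <= 5 * n + 1.
Proof.
by case: k => [[[[i []]|]|[i []]]|i] /=; try have := ltn_ord i; lia.
Qed.

(** The values fill disjoint blocks: base edges [1..n], spokes [n+1..2n] and [4n+1..5n], rim
    pendants the odd and the even numbers in [2n+1..4n], and [5n+1] at the hub. Since [i < n], no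
    subtraction truncates. *)
Lemma label_inj : injective label.
Proof.
move=> [[[[i []]|]|[i []]]|i] [[[[j []]|]|[j []]]|j] //= eq_ij;
  try (suff -> : i = j by []; apply: val_inj => /=);
  try have := ltn_ord i; try have := ltn_ord j; lia.
Qed.

Lemma labeling_bijection : @edge_bijection G labeling.
Proof.
split; rewrite ?card_edges indexed_edgeE.
- by move=> _ /imsetP[k _ ->]; rewrite labeling_indexed label_range.
- move=> _ _ /imsetP[k _ ->] /imsetP[l _ ->].
  by rewrite !labeling_indexed => /label_inj->.
- move=> m m_range.
  have lab_sub : {subset codom label <= iota 1 (5 * n + 1)}.
    by move=> _ /codomP[k ->]; rewrite mem_iota; have := label_range k; lia.
  have lab_uniq : uniq (codom label) by rewrite (map_inj_uniq label_inj) enum_uniq.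
  (* Surjectivity by counting: [5n+1] distinct labels fill an interval of [5n+1] integers. *)
  have [|_ lab_eq] := uniq_min_size lab_uniq lab_sub.
    by rewrite size_iota size_codom card_edge_index.
  have : m \in codom label by rewrite lab_eq mem_iota; lia.
  case/codomP => k ->; exists (indexed_edge k); first exact: imset_f.
  exact: labeling_indexed.
Qed.

Lemma labeling_weight_rim i b :
  weight labeling (rimv (i, b)) = if b then 5 * n + 1 else 8 * n + 2.
Proof.
by rewrite weight_rim !labeling_indexed /=; have := ltn_ord i; case: b; lia.
Qed.

(** The [n] spokes with large labels, each at least [4n+1], together with the pendant label [5n+1]
    already suffice. *)
Lemma labeling_weight_hub_gt : 1 < n -> 8 * n + 2 < weight labeling hub.
Proof.
move=> n_gt1; rewrite weight_hub labeling_indexed [label _]/=.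
have: \sum_(i < n) (4 * n + 1) <= \sum_p labeling (indexed_edge (spoke p)).
  rewrite (eq_bigr (fun p => labeling (indexed_edge (spoke (p.1, p.2))))); last first.
    by move=> [].
  rewrite -(pair_bigA _ (fun i b => labeling (indexed_edge (spoke (i, b))))).
  by apply: leq_sum => i _; rewrite (bigD1 false) // labeling_indexed /=; lia.
by rewrite sum_nat_const card_ord; nia.
Qed.

Lemma labeling_local_antimagic : 1 < n -> @local_antimagic G labeling.
Proof.
move=> n_gt1; split=> [|u v]; first exact: labeling_bijection.
have w_hub := labeling_weight_hub_gt n_gt1.
have spoke_gt0 p : 0 < labeling (indexed_edge (spoke p)).
  by rewrite labeling_indexed; case/andP: (label_range (spoke p)).
(* The leaf weight is one summand of its neighbour's weight. At a rim vertex the spoke adds a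
   positive amount; at the hub, [5n+1 < 8n+2] is enough. *)
have leaf_neq x : weight labeling (leaf x) <> weight labeling (inl x : G).
  apply/eqP; rewrite neq_ltn weight_leaf; apply/orP; left.
  case: x => [p|]; last by rewrite labeling_indexed; apply: ltn_trans w_hub => /=; lia.
  rewrite -[inl _]/(rimv p) weight_rim -addnA -[ltnLHS]addn0 ltn_add2l.
  by rewrite addn_gt0 spoke_gt0.
have rim_neq_hub p : weight labeling (rimv p) <> weight labeling hub.
  by case: p => i b; rewrite labeling_weight_rim; case: b; lia.
case: u v => [x|[x h]] [y|[y k]] /=; last by rewrite andbF.
- case: x y => [[i a]|] [[j b]|] //=.
  + case/andP=> _; rewrite -![inl (Some _)]/(rimv _) !labeling_weight_rim.
    by case: a b => [] [] //= _; lia.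
  + by move=> _; exact: rim_neq_hub.
  + by move=> _ /esym; exact: rim_neq_hub.
- by move=> /eqP->; rewrite [k]ord1 => /esym; exact: leaf_neq.
- by move=> /eqP->; rewrite [h]ord1; exact: leaf_neq.
Qed.

Lemma num_colors_labeling_le : @num_colors G labeling <= 2 * n + 3.
Proof.
(* The [iota] block holds the colors of the leaves at rim vertices; [5n+1] is shared by the hub's
   leaf and one rim vertex of each triangle. *)
pose s := iota (2 * n + 1) (2 * n) ++ [:: 5 * n + 1; 8 * n + 2; weight labeling hub].
have -> : 2 * n + 3 = size s by rewrite size_cat size_iota.
apply: uniq_leq_size (undup_uniq _) _ => w; rewrite mem_undup => /codomP[u ->].
rewrite mem_cat !inE mem_iota.
have [[x ->]|[->|[[i b] ->]]] := vertexP u.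
- rewrite weight_leaf labeling_indexed; case: x => [[i b]|] /=; last by lia.
  by have := ltn_ord i; case: b; lia.
- by rewrite eqxx !orbT.
- by rewrite labeling_weight_rim; case: b; rewrite eqxx ?orbT.
Qed.

End FriendshipCorona.

Theorem theorem3p1 (n : nat) (hn : 2 <= n) :
  is_chi_la (corona (friendship n) (null_graph 1)) (2 * n + 3).
Proof.
split=> [|f f_la]; last exact: num_colors_ge.
have lab_la := labeling_local_antimagic hn.
exists (@labeling n) => //; apply/eqP.
(* The lower bound, applied to [labeling] itself, turns the upper estimate into an equality. *)
by rewrite eqn_leq num_colors_labeling_le num_colors_ge.
Qed.
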